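(* Let $D$ be a finite digraph whose Sperner capacity is attained in finite length, i.e. there is a positive integer $k$ with $C_{\rm Sp}(D)=\sqrt[k]{\omega_{\rm tr}(D^k)}$. Then $C_{\rm Sp}(M(D))>C_{\rm Sp}(D)$.
   Context: Digraphs have no loops. For digraphs $F,G$, the OR-product $F\cdot G$ has vertex set $V(F)\times V(G)$ and a directed edge from $(f,g)$ to $(f',g')$ iff $(f,f')\in E(F)$ or $(g,g')\in E(G)$; $D^t$ is the $t$-fold OR-product of $D$ with itself. The transitive clique number $\omega_{\rm tr}(D)$ is the largest $m$ such that there are distinct vertices $q_1,\dots,q_m$ of $D$ with $(q_i,q_j)\in E(D)$ for all $i<j$. The Sperner capacity is $C_{\rm Sp}(D)=\lim_{t\to\infty}\sqrt[t]{\omega_{\rm tr}(D^t)}$. The Mycielskian $M(D)$ of a digraph $D$ has vertex set $V(D)\times\{0,1\}\cup\{z\}$ ($z$ a new vertex) and edge set $\{((v,0),(w,i)):(v,w)\in E(D),\ i\in\{0,1\}\}\cup\{((v,1),(w,0)):(v,w)\in E(D)\}\cup\{(z,(v,1)):v\in V(D)\}$. *)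

(* Defs.v *)
From mathcomp Require Import all_boot all_order all_algebra.
From mathcomp Require Import all_classical all_reals all_analysis.

Set Implicit Arguments.
Unset Strict Implicit.
Unset Printing Implicit Defensive.

Import Order.TTheory GRing.Theory Num.Theory.
Import numFieldNormedType.Exports.

Local Open Scope classical_set_scope.
Local Open Scope ring_scope.

Record digraph := Digraph {
  vertex :> finType;
  edge : rel vertex;
  edge_irr : irreflexive edge
}.

Definition or_edge (F G : digraph) : rel (F * G) :=
  fun x y => edge x.1 y.1 || edge x.2 y.2.

Lemma or_edge_irr (F G : digraph) : irreflexive (@or_edge F G).
Proof. by move=> x; rewrite /or_edge !edge_irr. Qed.

Definition or_prod (F G : digraph) : digraph := Digraph (@or_edge_irr F G).

Lemma point_edge_irr : irreflexive (fun _ _ : unit => false).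
Proof. by []. Qed.

Definition point_digraph : digraph := Digraph point_edge_irr.

(* D^1 is D itself and D^(t+1) is D . D^t for t >= 1. The one-vertex digraph, *)
(* which is neutral for the OR-product up to isomorphism, only serves as D^0. *)
Definition or_pow (D : digraph) (t : nat) : digraph :=
  iterop t or_prod D point_digraph.

(* The bound m <= #|D| loses nothing, the q_i being distinct. *)
Definition omega_tr (D : digraph) : nat :=
  (\max_(m < #|D|.+1 |
      [exists q : m.-tuple D, uniq q && pairwise (@edge D) q]) m)%N.

(* The t-th root is the power t^-1; the meaningless term t = 0 is 1. *)
Definition omega_tr_root (R : realType) (D : digraph) (t : nat) : R :=
  (omega_tr (or_pow D t))%:R `^ t%:R^-1.

Definition sperner_capacity (R : realType) (D : digraph) : R :=
  lim (omega_tr_root R D @ \oo).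

(* Some (v, false) is (v,0), Some (v, true) is (v,1), and None is z. *)
Definition mycielski_edge (D : digraph) : rel (option (D * bool)) :=
  fun x y => match x, y with
  | Some (v, false), Some (w, _) => edge v w
  | Some (v, true), Some (w, false) => edge v w
  | None, Some (_, true) => true
  | _, _ => false
  end.

Lemma mycielski_edge_irr (D : digraph) : irreflexive (@mycielski_edge D).
Proof. by case=> [[v []]|] //=; rewrite edge_irr. Qed.

Definition mycielskian (D : digraph) : digraph :=
  Digraph (@mycielski_edge_irr D).

(* Main.v *)
(* Let m be the transitive clique number of D^k, where the capacity of D is
   attained.  The m-fold product of a maximum clique of D^k consists of the
   words x in {0..m-1}^m.  Mark in every word the block whose index is the sum
   of x modulo m, and move that block to the level-1 copy of D in M(D), all
   other blocks going to the level-0 copy.  A coordinate edge survives unless it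
   lies in a block marked in both words; ordering the words by sum, ties being
   broken by decreasing marked letter, any two words keep an edge.  As every
   word now has a level-1 coordinate, (z,...,z) precedes all of them, so M(D)^(km)
   has a transitive clique of size m^m + 1.  By Fekete's lemma the capacity of
   M(D) is at least the (km)-th root of m^m + 1, which exceeds that of m^m. *)

Require Import Defs.
From mathcomp Require Import all_boot all_order all_algebra.
From mathcomp Require Import all_classical all_reals all_analysis.
From mathcomp Require Import zify lra.

Set Implicit Arguments.
Unset Strict Implicit.
Unset Printing Implicit Defensive.

Import Order.TTheory GRing.Theory Num.Theory.
Import numFieldNormedType.Exports.

Local Open Scope classical_set_scope.
Local Open Scope ring_scope.

(** * Transitive cliques under homomorphisms and OR-products *)

Lemma pairwise_edge_uniq (G : digraph) (s : seq G) :
  pairwise (@edge G) s -> uniq s.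
Proof.
rewrite uniq_pairwise; apply: sub_pairwise => x y /= xy.
by apply: contraTneq xy => ->; rewrite edge_irr.
Qed.

Lemma leq_omega_tr (G : digraph) (s : seq G) :
  pairwise (@edge G) s -> (size s <= omega_tr G)%N.
Proof.
move=> sP; have s_uniq := pairwise_edge_uniq sP.
have s_le : (size s < #|G|.+1)%N by rewrite ltnS -(card_uniqP s_uniq) max_card.
rewrite /omega_tr; apply: (bigop.bigmax_sup (Ordinal s_le)) => //=.
by apply/existsP; exists (in_tuple s); rewrite s_uniq.
Qed.

Lemma omega_tr_clique (G : digraph) :
  exists2 s : seq G, pairwise (@edge G) s & size s = omega_tr G.
Proof.
pose P (m : 'I_#|G|.+1) :=
  [exists q : m.-tuple G, uniq q && pairwise (@edge G) q].
have P0 : (0 < #|P|)%N.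
  by apply/card_gt0P; exists ord0; apply/existsP; exists [tuple].
have [m /existsP[q /andP[_ qP]] omE] :=
  eq_bigmax_cond (fun m : 'I_#|G|.+1 => val m) P0.
exists (val q) => //; rewrite size_tuple [LHS](_ : _ = val m) // -omE.
Qed.

Lemma omega_tr_leq_card (G : digraph) : (omega_tr G <= #|G|)%N.
Proof. by apply/bigmax_leqP => m _; rewrite -ltnS. Qed.

Lemma omega_tr_gt0 (G : digraph) (v : G) : (0 < omega_tr G)%N.
Proof. exact: (@leq_omega_tr G [:: v]). Qed.

(** Adjacent vertices have adjacent, hence distinct, images because loops are absent; so a clique
    maps to a clique of the same size. *)
Lemma omega_tr_homo (F G : digraph) (f : F -> G) :
  {homo f : x y / edge x y} -> (omega_tr F <= omega_tr G)%N.
Proof.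
move=> f_homo; have [s sP <-] := omega_tr_clique F.
rewrite -(size_map f); apply: leq_omega_tr; rewrite pairwise_map.
exact: sub_pairwise sP.
Qed.

(** Pairs of clique members are listed lexicographically: the first differing coordinate supplies
    the edge. *)
Lemma omega_tr_or_prod (F G : digraph) :
  (omega_tr F * omega_tr G <= omega_tr (or_prod F G))%N.
Proof.
have [s sP <-] := omega_tr_clique F; have [t tP <-] := omega_tr_clique G.
rewrite -(size_allpairs (fun x y => (x, y) : or_prod F G)).
apply: leq_omega_tr; elim: s sP => //= x s IHs /andP[xs sP].
rewrite pairwise_cat pairwise_map IHs // andbT; apply/andP; split; last first.
  by apply: sub_pairwise tP => y z yz /=; rewrite /or_edge /= yz orbT.
apply/allrelP => _ _ /mapP[y _ ->] /allpairsP[[x' y'] [/= x's _ ->]].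
by rewrite /or_edge /= (allP xs).
Qed.

(** * OR-powers with coordinates indexed by a finite type *)

(** An arbitrary index type lets coordinates be grouped by sums and products of index sets, without
    reassociating nested pairs. *)
Definition fun_edge (D : digraph) (I : finType) : rel {ffun I -> D} :=
  fun x y => [exists i, edge (x i) (y i)].

Lemma fun_edge_irr (D : digraph) (I : finType) : irreflexive (@fun_edge D I).
Proof. by move=> x; apply/existsP => -[i]; rewrite edge_irr. Qed.

Definition fun_pow (D : digraph) (I : finType) : digraph :=
  Digraph (@fun_edge_irr D I).

Lemma or_pow_to_fun_pow (D : digraph) (n : nat) :
  exists f : or_pow D n -> fun_pow D 'I_n, {homo f : x y / edge x y}.
Proof.
(* [iterop] gives [D] itself at exponent 1, so exponents 0 and 1 are separate cases. *)
elim: n => [|[|n] [f fP]]; first by exists (fun=> ffun0 (card_ord 0)).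
  exists (fun x : D => [ffun=> x]) => x y xy /=.
  by apply/existsP; exists ord0; rewrite !ffunE.
exists (fun x : D * or_pow D n.+1 =>
  [ffun i => if unlift ord0 i is Some j then f x.2 j else x.1]).
move=> [x1 x2] [y1 y2] /orP[/= xy|/= /fP /existsP[j xy]].
  by apply/existsP; exists ord0; rewrite !ffunE unlift_none.
by apply/existsP; exists (lift ord0 j); rewrite !ffunE liftK.
Qed.

Lemma fun_pow_to_or_pow (D : digraph) (n : nat) :
  exists f : fun_pow D 'I_n -> or_pow D n, {homo f : x y / edge x y}.
Proof.
elim: n => [|[|n] [f fP]].
- by exists (fun=> tt) => x y /existsP[[]].
- exists (fun x : {ffun 'I_1 -> D} => x ord0) => x y /existsP[i].
  by rewrite (ord1 i).
exists (fun x : {ffun 'I_n.+2 -> D} =>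
  (x ord0, f [ffun j => x (lift ord0 j)]) : or_pow D n.+2).
move=> x y /existsP[i]; case: (unliftP ord0 i) => [j ->|->] xy; last first.
  by apply/orP; left.
by apply/orP; right; apply: fP; apply/existsP; exists j; rewrite !ffunE.
Qed.

(** Pulling back along the surjection [f] keeps every edge: one at coordinate [i] reappears at
    [g i]. *)
Lemma omega_tr_fun_pow_reindex (D : digraph) (I J : finType) (f : J -> I)
    (g : I -> J) :
  cancel g f -> (omega_tr (fun_pow D I) <= omega_tr (fun_pow D J))%N.
Proof.
move=> gK; pose h (x : {ffun I -> D}) := [ffun j => x (f j)].
apply: (@omega_tr_homo _ _ (h : fun_pow D I -> fun_pow D J)).
move=> x y /existsP[i xy].
by apply/existsP; exists (g i); rewrite !ffunE gK.
Qed.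

Lemma omega_tr_fun_pow (D : digraph) (I : finType) :
  omega_tr (fun_pow D I) = omega_tr (or_pow D #|I|).
Proof.
have [f /omega_tr_homo f_le] := or_pow_to_fun_pow D #|I|.
have [g /omega_tr_homo g_le] := fun_pow_to_or_pow D #|I|.
apply/eqP; rewrite eqn_leq; apply/andP; split.
  by apply: leq_trans g_le; apply: omega_tr_fun_pow_reindex enum_rankK.
by apply: (leq_trans f_le); apply: omega_tr_fun_pow_reindex enum_valK.
Qed.

Lemma omega_tr_fun_pow_ord (D : digraph) (n : nat) :
  omega_tr (or_pow D n) = omega_tr (fun_pow D 'I_n).
Proof. by rewrite omega_tr_fun_pow card_ord. Qed.

Lemma omega_tr_or_pow_gt0 (D : digraph) (v : D) (t : nat) :
  (0 < omega_tr (or_pow D t))%N.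
Proof.
rewrite omega_tr_fun_pow_ord.
exact: (@omega_tr_gt0 (fun_pow D 'I_t) [ffun=> v]).
Qed.

Lemma omega_tr_or_pow_leq (D : digraph) (t : nat) :
  (omega_tr (or_pow D t) <= #|D| ^ t)%N.
Proof.
rewrite omega_tr_fun_pow_ord.
apply: leq_trans (omega_tr_leq_card _) _.
by rewrite /= card_ffun card_ord.
Qed.

Lemma omega_tr_or_powD (D : digraph) (a b : nat) :
  (omega_tr (or_pow D a) * omega_tr (or_pow D b) <=
   omega_tr (or_pow D (a + b)))%N.
Proof.
have -> : (a + b = #|{: 'I_a + 'I_b}|)%N by rewrite card_sum !card_ord.
rewrite -omega_tr_fun_pow !omega_tr_fun_pow_ord.
apply: leq_trans (omega_tr_or_prod _ _) _.
pose h (x : {ffun 'I_a -> D} * {ffun 'I_b -> D}) :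
    fun_pow D ('I_a + 'I_b)%type :=
  [ffun k => match k with inl i => x.1 i | inr j => x.2 j end].
apply: (@omega_tr_homo (or_prod (fun_pow D 'I_a) (fun_pow D 'I_b)) _ h).
move=> x y /orP[] /existsP[i xy]; apply/existsP.
  by exists (inl i); rewrite !ffunE.
by exists (inr i); rewrite !ffunE.
Qed.

(** * Words, their marked blocks and their ranks *)

Section Words.
Variable n : nat.
Implicit Types x y : {ffun 'I_n.+1 -> 'I_n.+1}.

Definition word_sum x : nat := (\sum_b x b)%N.

Definition word_mark x : 'I_n.+1 := inord (word_sum x %% n.+1).

(** Encodes a lexicographic order in one number: the second summand lies between 1 and n+1, so it
    only decides between words of equal sum. *)
Definition word_rank x : nat :=
  (n.+1 * word_sum x + (n.+1 - x (word_mark x)))%N.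

Lemma word_sumD1 x b :
  word_sum x = (x b + \sum_(i | i != b) x i)%N.
Proof. by rewrite /word_sum (bigD1 b). Qed.

Lemma leq_sum_eq (P : pred 'I_n.+1) x y :
  (forall b, P b -> (y b <= x b)%N) ->
  (\sum_(b | P b) x b <= \sum_(b | P b) y b)%N ->
  forall b, P b -> x b = y b.
Proof.
move=> yx le_xy b Pb; apply/val_inj/eqP; rewrite eq_sym.
have /leqif_sum lif : forall i, P i ->
    (y i <= x i ?= iff (y i == x i :> nat))%N.
  by move=> i Pi; split; [exact: yx|].
have : ((\sum_(b | P b) y b == \sum_(b | P b) x b))%N.
  by rewrite eqn_leq lif.1.
by rewrite lif.2 => /forall_inP/(_ b Pb).
Qed.

(* A strict increase at an unmarked block always exists: within one residue
   class the sums differ by a multiple of n+1, which no single block can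
   account for, and for equal sums the rank makes the marked block decrease. *)
Lemma word_rank_increase x y :
  x != y -> (word_rank x <= word_rank y)%N ->
  exists2 b, (x b < y b)%N & ~~ ((word_mark x == b) && (word_mark y == b)).
Proof.
move=> neq_xy le_xy.
have [/existsP[b /andP[]]|/existsPn no_b] := boolP [exists b,
    (x b < y b)%N && ~~ ((word_mark x == b) && (word_mark y == b))].
  by exists b.
(* With no such block, the rest derives x = y, against [neq_xy]. *)
have le_b b : ~~ ((word_mark x == b) && (word_mark y == b)) -> (y b <= x b)%N.
  by move=> ub; have := no_b b; rewrite ub andbT -leqNgt.
have le_sum : (word_sum x <= word_sum y)%N.
  move: le_xy; rewrite /word_rank.
  have := ltn_ord (x (word_mark x)); have := ltn_ord (y (word_mark y)).
  move: (word_sum x) (word_sum y) => a b; nia.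
case/eqP: neq_xy; apply/ffunP => b.
(* If the marks differ, no block is marked in both words, so y is below x everywhere and [le_sum]
   forces equality. *)
have [eq_c|neq_c] := eqVneq (word_mark x) (word_mark y); last first.
  apply: (@leq_sum_eq predT) => // {}b _; apply: le_b.
  by apply: contra neq_c => /andP[/eqP-> /eqP->].
set c := word_mark x in eq_c.
have le_c i : i != c -> (y i <= x i)%N.
  by move=> ic; apply: le_b; rewrite -/c eq_sym (negbTE ic).
have le_T := leq_sum (index_enum _) le_c.
have := word_sumD1 x c; have := word_sumD1 y c.
have eq_mod : (word_sum x = word_sum y %[mod n.+1])%N.
  by have /(congr1 val) := eq_c; rewrite /c /word_mark /= !inordK ?ltn_pmod.
have eq_sum : word_sum x = word_sum y.
  apply/eqP; rewrite eqn_leq le_sum /= leqNgt; apply/negP => lt_sum.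
  have : (n.+1 %| word_sum y - word_sum x)%N by rewrite -eqn_mod_dvd // eq_mod.
  move=> /dvdn_leq; rewrite subn_gt0 => /(_ lt_sum).
  have := word_sumD1 x c; have := word_sumD1 y c.
  move: le_T (ltn_ord (y c)).
  move: (\sum_(i | i != c) x i)%N (\sum_(i | i != c) y i)%N => a a'; lia.
have le_yxc : (y c <= x c)%N.
  move: le_xy; rewrite /word_rank eq_sum leq_add2l -eq_c -/c.
  have := ltn_ord (y c); have := ltn_ord (x c); lia.
move=> Sy Sx; have [->|bc] := eqVneq b c; last first.
  apply: (@leq_sum_eq (fun i => i != c)) => //.
  by rewrite -(leq_add2l (x c)) -Sx eq_sum Sy leq_add2r.
apply/val_inj/eqP; rewrite eqn_leq le_yxc andbT.
by rewrite -(leq_add2r (\sum_(i | i != c) x i)%N) -Sx eq_sum Sy leq_add2l.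
Qed.

End Words.

(** * The enlarged clique in a power of the Mycielskian *)

Lemma mycielskian_edge (D : digraph) (v w : D) (a b : bool) :
  edge v w -> ~~ (a && b) ->
  @edge (mycielskian D) (Some (v, a)) (Some (w, b)).
Proof. by case: a b => [] []. Qed.

Lemma omega_tr_mycielskian_pow (D : digraph) (k n : nat) :
  (0 < k)%N -> omega_tr (or_pow D k) = n.+1 ->
  (n.+1 ^ n.+1 < omega_tr (or_pow (mycielskian D) (n.+1 * k)))%N.
Proof.
move=> k_gt0; rewrite omega_tr_fun_pow_ord => omE.
have -> : (n.+1 * k = #|{: 'I_n.+1 * 'I_k}|)%N by rewrite card_prod !card_ord.
rewrite -omega_tr_fun_pow.
have [q qP] := omega_tr_clique (fun_pow D 'I_k); rewrite omE => q_size.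
have x0 : fun_pow D 'I_k by case: q q_size {qP}.
have q_edge (a b : 'I_n.+1) : (a < b)%N ->
    exists j, edge ((nth x0 q a : {ffun _ -> _}) j)
                   ((nth x0 q b : {ffun _ -> _}) j).
  move=> ab; apply/existsP; move/(pairwiseP x0) : qP; apply => //;
    by rewrite inE q_size.
pose M := fun_pow (mycielskian D) ('I_n.+1 * 'I_k)%type.
(* Block [b] spells out the clique member numbered [x b], on level 1 exactly when [b] is marked. *)
pose lift (x : {ffun 'I_n.+1 -> 'I_n.+1}) : M :=
  [ffun p => Some ((nth x0 q (x p.1) : {ffun _ -> _}) p.2, word_mark x == p.1)].
pose le (x y : {ffun 'I_n.+1 -> 'I_n.+1}) := (word_rank x <= word_rank y)%N.
pose ws := sort le (enum {ffun 'I_n.+1 -> 'I_n.+1}).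
have ws_size : size ws = (n.+1 ^ n.+1)%N.
  by rewrite size_sort -cardE card_ffun card_ord.
rewrite -ws_size -(size_map lift).
apply: (@leq_omega_tr M ([ffun=> None] :: map lift ws)).
rewrite /= pairwise_map; apply/andP; split.
  apply/allP => _ /mapP[x _ ->]; apply/existsP.
  (* z points only to level 1; the marked block has a coordinate there since [k] is positive. *)
  by exists (word_mark x, Ordinal k_gt0); rewrite !ffunE /= eqxx.
have ws_uniq : pairwise (fun x y => x != y) ws.
  by rewrite -uniq_pairwise sort_uniq enum_uniq.
have ws_le : pairwise le ws.
  rewrite -sorted_pairwise; last by move=> x y z; exact: leq_trans.
  by apply: sort_sorted => x y; exact: leq_total.
have /andP := conj ws_uniq ws_le; rewrite -pairwise_relI.
apply: sub_pairwise => x y /andP[/= neq_xy /word_rank_increase].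
move=> /(_ neq_xy)[b /q_edge[j xy] not_marked].
by apply/existsP; exists (b, j); rewrite !ffunE; exact: mycielskian_edge.
Qed.

(** * Fekete's lemma and the capacity as a supremum *)

Section Capacity.
Variable R : realType.

Lemma superadditive_cvg (a : nat -> R) (B : R) :
  (forall s t, a s + a t <= a (s + t)%N) -> (forall t, 0 <= a t) ->
  (forall t, a t <= B * t%:R) ->
  exists2 l, a t / t%:R @[t --> \oo] --> l &
    forall t, (0 < t)%N -> a t / t%:R <= l.
Proof.
move=> aD a_ge0 a_le; pose E := [set a t / t%:R | t in [set t | (0 < t)%N]].
have E_sup : has_sup E.
  split; first by exists (a 1%N / 1%:R); exists 1%N.
  exists B => _ [t /= t_gt0 <-].
  by rewrite ler_pdivrMr ?ltr0n.
have le_sup t : (0 < t)%N -> a t / t%:R <= sup E.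
  by move=> t_gt0; apply: sup_upper_bound => //; exists t.
exists (sup E) => //.
have aM N q r : a N *+ q <= a (q * N + r)%N.
  elim: q => [|q IHq]; first by rewrite mulr0n a_ge0.
  by rewrite mulrS mulSn -addnA; apply: le_trans (aD _ _); rewrite lerD2l.
apply/cvgrPdist_le => e e_gt0.
have e2_gt0 : 0 < e / 2 by rewrite divr_gt0.
have [_ [N /= N_gt0 <-] sup_lt] := sup_adherent e2_gt0 E_sup.
near=> t.
have t_gt0 : (0 < t)%N by near: t; exact: nbhs_infty_gt.
have t_ge : a N / (e / 2) <= t%:R by near: t; exact: nbhs_infty_ger.
rewrite ger0_norm ?subr_ge0 ?le_sup //.
have tR : 0 < t%:R :> R by rewrite ltr0n.
have NR : 0 < N%:R :> R by rewrite ltr0n.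
have aNt : a N / t%:R <= e / 2.
  by move: t_ge; rewrite ler_pdivrMr // ler_pdivrMr // mulrC.
(* Write t = qN + r: then q a(N) is at most a(t) and t is at most (q+1)N, so rounding costs at most
   a(N)/t. *)
have key : a N / N%:R <= a t / t%:R + a N / t%:R.
  rewrite -mulrDl ler_pdivrMr // mulrAC ler_pdivlMr //.
  have := aM N (t %/ N)%N (t %% N)%N; rewrite -divn_eq => at_ge.
  have t_le : t%:R <= ((t %/ N)%N%:R + 1) * N%:R :> R.
    rewrite natr1 -natrM ler_nat {1}(divn_eq t N) mulSn addnC leq_add2r.
    by rewrite ltnW // ltn_pmod.
  apply: le_trans (ler_wpM2l (a_ge0 N) t_le) _.
  rewrite mulrA; apply: ler_wpM2r; first exact: ltW.
  by rewrite mulrDr mulr1 mulr_natr lerD2r.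
lra.
Unshelve. all: by end_near. Qed.

Lemma natr_powR_inv (m t : nat) :
  (0 < m)%N -> m%:R `^ t%:R^-1 = expR (ln m%:R / t%:R) :> R.
Proof. by move=> m_gt0; rewrite /powR pnatr_eq0 gtn_eqF // mulrC. Qed.

(** The vertex [v] makes all clique numbers positive, so their logarithms are superadditive;
    Fekete's limit is their supremum, and [expR] carries this back to the roots. *)
Lemma sperner_capacity_ge (D : digraph) (v : D) :
  0 < sperner_capacity R D /\
  forall t, (0 < t)%N -> omega_tr_root R D t <= sperner_capacity R D.
Proof.
pose w t := omega_tr (or_pow D t).
have w_gt0 t : (0 < w t)%N by exact: omega_tr_or_pow_gt0.
have w_pos t : (w t)%:R \is @Num.pos R by rewrite posrE ltr0n.
have D_gt0 : (0 < #|D|)%N by apply/card_gt0P; exists v.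
have rootE : omega_tr_root R D =
    expR \o (fun t => ln (w t)%:R / t%:R).
  by apply/funext => t; rewrite /omega_tr_root natr_powR_inv //; exact: w_gt0.
have [|||l cvg_l l_ge] :=
  @superadditive_cvg (fun t => ln (w t)%:R) (ln #|D|%:R).
- move=> s t; rewrite -lnM // -natrM ler_ln ?posrE ?ltr0n ?muln_gt0 ?w_gt0 //.
  by rewrite ler_nat omega_tr_or_powD.
- by move=> t; rewrite ln_ge0 // ler1n w_gt0.
- move=> t; rewrite mulr_natr -lnXn ?ltr0n // -natrX.
  rewrite ler_ln ?posrE ?ltr0n ?expn_gt0 ?D_gt0 // ler_nat.
  exact: omega_tr_or_pow_leq.
have -> : sperner_capacity R D = expR l.
  rewrite /sperner_capacity rootE; apply: cvg_lim => //.
  by apply: continuous_cvg => //; exact: continuous_expR.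
split; first exact: expR_gt0.
by move=> t t_gt0; rewrite rootE /= ler_expR l_ge.
Qed.

End Capacity.

Theorem theorem7 (R : realType) (D : digraph)
    (attained : exists k : nat,
       (0 < k)%N /\
       sperner_capacity R D = (omega_tr (or_pow D k))%:R `^ k%:R^-1) :
  sperner_capacity R D < sperner_capacity R (mycielskian D).
Proof.
case: attained => k [k_gt0 ->].
have [cap_gt0 cap_ge] := @sperner_capacity_ge R (mycielskian D) None.
case omE: (omega_tr (or_pow D k)) => [|n].
  (* Here [D] is empty and the root is 0, while the vertex z makes the capacity of M(D) positive. *)
  by rewrite powR0 // invr_eq0 pnatr_eq0 -lt0n.
have := omega_tr_mycielskian_pow k_gt0 omE.
set N := (n.+1 * k)%N; have N_gt0 : (0 < N)%N by rewrite muln_gt0.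
move=> lt_om; apply: lt_le_trans (cap_ge _ N_gt0).
rewrite /omega_tr_root !natr_powR_inv //; last exact: leq_ltn_trans lt_om.
(* With m = n+1, the k-th root of m is the (mk)-th root of m^m. *)
have -> : ln n.+1%:R / k%:R = ln (n.+1 ^ n.+1)%N%:R / N%:R :> R.
  rewrite natrX lnXn ?ltr0n // -[ln _ *+ _]mulr_natl /N natrM.
  by rewrite -mulf_div divff ?mul1r //.
rewrite ltr_expR ltr_pM2r ?invr_gt0 ?ltr0n // ltr_ln ?posrE ?ltr0n ?ltr_nat //.
  by rewrite expn_gt0.
exact: leq_ltn_trans lt_om.
Qed.
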